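(* Let $G$ be a discrete group acting continuously on a Hausdorff space $X$, and let $G\ltimes X$ be the associated translation groupoid. Then $$\operatorname{cat}_{grd}(G\ltimes X)=\operatorname{cat}_G(X),$$ that is, the groupoid category of $G\ltimes X$ equals the equivariant (Fadell) category of the $G$-space $X$.
   Context: **Translation groupoids.** For a topological group $G$ acting continuously on a Hausdorff space $X$, the translation groupoid $G\ltimes X$ has space of objects $X$ and space of arrows $G\times X$, where $(g,x)$ is an arrow from $x$ to $gx$, with composition induced by multiplication in $G$. An *equivariant map* $m\ltimes\epsilon: K\ltimes Z\to G\ltimes X$ consists of a (continuous) group homomorphism $m:K\to G$ and a continuous map $\epsilon:Z\to X$ with $\epsilon(kz)=m(k)\epsilon(z)$ for all $k\in K$, $z\in Z$. A $G$-map $f:U\to X$ between $G$-spaces (continuous, $f(gu)=gf(u)$) is regarded as the equivariant map $\mathrm{id}_G\ltimes f$. **Natural transformations.** For equivariant maps $m\ltimes\phi,\ n\ltimes\psi: K\ltimes Z\to G\ltimes X$, a natural transformation from $\phi$ to $\psi$ is a continuous map $\lambda:Z\to G$ with $\lambda(z)\phi(z)=\psi(z)$ and $n(k)\lambda(z)=\lambda(kz)m(k)$ for all $k\in K,z\in Z$. Write $\phi\sim\psi$ if one exists. **Essential equivalences.** An equivariant map $m\ltimes\epsilon:K\ltimes Z\to H\ltimes Y$ is an essential equivalence if (1) the map $H\times Z\to Y$, $(h,z)\mapsto h\epsilon(z)$, is an open surjection; and (2) the map $K\times Z\to \{((h,y),(z,z'))\in (H\times Y)\times(Z\times Z) : y=\epsilon(z),\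 hy=\epsilon(z')\}$ given by $(k,z)\mapsto((m(k),\epsilon(z)),(z,kz))$ is a homeomorphism (i.e. the arrow space $K\times Z$ is the pullback). **Generalized maps.** A generalized map from $H\ltimes Y$ to $G\ltimes X$ is a pair $(\epsilon,\phi)$: $H\ltimes Y\xleftarrow{\epsilon}K\ltimes Z\xrightarrow{\phi}G\ltimes X$ of equivariant maps with $\epsilon$ an essential equivalence. An equivariant map $f$ is regarded as the generalized map $(\mathrm{id},f)$. Two generalized maps $H\ltimes Y\xleftarrow{\epsilon}K\ltimes Z\xrightarrow{\phi}G\ltimes X$ and $H\ltimes Y\xleftarrow{\epsilon'}K'\ltimes Z'\xrightarrow{\phi'}G\ltimes X$ are 2-isomorphic if there are a translation groupoid $\mathcal L$ and essential equivalences $\nu:\mathcal L\to K\ltimes Z$, $\mu:\mathcal L\to K'\ltimes Z'$ with $\epsilon\nu\sim\epsilon'\mu$ and $\phi\nu\sim\phi'\mu$. **grd-homotopy** (all groups discrete). Let $X^I$ be the space of continuous paths $I=[0,1]\to X$ with the pointwise $G$-action, and let $ev_0,ev_1:G\ltimes X^I\to G\ltimes X$ be evaluation at $0$ and $1$ (identity on $G$). Two equivariant maps $f,g:K\ltimes Y\to G\ltimes X$ are grd-homotopic if there is a generalized map $K\ltimes Y\xleftarrow{\epsilon}\tilde K\ltimes\tilde Y\xrightarrow{H}G\ltimes X^I$ such that the generalized map $(\epsilon, ev_0\circ H)$ is 2-isomorphic to $(\mathrm{id},f)$ and $(\epsilon, ev_1\circ H)$ is 2-isomorphic to $(\mathrm{id},g)$.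 **Equivariant category.** A $G$-homotopy between $G$-maps $U\to X$ is a $G$-map $U\times I\to X$ ($G$ acting trivially on $I$) restricting to them at $0$ and $1$. A $G$-invariant subset $U\subseteq X$ is *$G$-categorical* if the inclusion $i_U:U\to X$ is $G$-homotopic to a $G$-map $c:U\to X$ with $c(U)$ contained in a single orbit. $\operatorname{cat}_G(X)$ is the least integer $k$ such that $X$ can be covered by $k$ open $G$-categorical (in particular $G$-invariant) sets. **Groupoid category.** A $G$-invariant subset $U\subseteq X$ is *grd-categorical* if the inclusion $i_U:G\ltimes U\to G\ltimes X$ is grd-homotopic to an equivariant map $c:G\ltimes U\to G\ltimes X$ whose object map has image $c(U)$ contained in a single $G$-orbit. $\operatorname{cat}_{grd}(G\ltimes X)$ is the least integer $k$ such that $X$ can be covered by $k$ open grd-categorical (in particular $G$-invariant) sets. In both definitions, the value is $\infty$ if no finite cover exists. *)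

(* Defs.v *)
From HB Require Import structures.
From mathcomp Require Import all_boot all_order all_algebra.
From mathcomp Require Import all_classical all_reals topology.

Set Implicit Arguments.
Unset Strict Implicit.
Unset Printing Implicit Defensive.

Import Order.TTheory GRing.Theory Num.Theory numFieldTopology.Exports.

Local Open Scope classical_set_scope.

(* Groups are discrete: as the topology is discrete, the group operations are
   continuous automatically. *)
#[short(type="discreteGroupType")]
HB.structure Definition DiscreteGroup :=
  {G of Group G & DiscreteTopology G}.

HB.instance Definition _ (G : groupType) := Group.on (discrete_topology G).

Section General_topology.

Definition open_map (S T : topologicalType) (f : S -> T) : Prop :=
  forall O : set S, open O -> open (f @` O).

Definition homeomorphism (S T : topologicalType) (f : S -> T) : Prop :=
  continuous f /\
  exists f' : T -> S, [/\ continuous f', cancel f f' & cancel f' f].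

Lemma continuous_pair (S T U : topologicalType) (f : S -> T) (g : S -> U) :
  continuous f -> continuous g -> continuous (fun s => (f s, g s)).
Proof. by move=> cf cg s; apply: cvg_pair; [exact: cf | exact: cg]. Qed.

Lemma continuous_set_val (X : topologicalType) (U : set X) :
  continuous (val : set_type U -> X).
Proof. exact: (@initial_continuous U X set_val). Qed.

Lemma continuous_to_set_type (S X : topologicalType) (U : set X)
    (f : S -> set_type U) : continuous (fun s => val (f s)) -> continuous f.
Proof.
move=> cf; apply/continuousP => A [B oB <-].
by move/continuousP: cf => /(_ B oB).
Qed.

Lemma hausdorff_inj (S T : topologicalType) (f : S -> T) :
  injective f -> continuous f -> hausdorff_space T -> hausdorff_space S.
Proof.
move=> injf cf hT p q cpq; apply/injf/hT => A B /cf fA /cf fB.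
by have [s [As Bs]] := cpq _ _ fA fB; exists (f s).
Qed.

Lemma continuous_discrete_prod (G : discreteTopologicalType)
    (S T : topologicalType) (f : G -> S -> T) :
  (forall g, continuous (f g)) -> continuous (fun gs : G * S => f gs.1 gs.2).
Proof.
move=> cf [g s] A /= nA; exists ([set g], f g @^-1` A) => /=.
  by split; [rewrite nbhs_principalE; apply/principal_filterP | exact: cf].
by move=> [g' s'] /= [-> ].
Qed.

Lemma continuous_slice (G S T : topologicalType) (f : G -> S -> T) :
  continuous (fun gs : G * S => f gs.1 gs.2) -> forall g, continuous (f g).
Proof.
move=> cf g s; apply: (@continuous_comp _ _ _ (fun s => (g, s))
  (fun gs => f gs.1 gs.2) s); last exact: cf.
by apply: cvg_pair => //=; exact: cvg_cst.
Qed.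

End General_topology.

Section Actions.
Variable G : discreteGroupType.

Record is_action (X : topologicalType) (act : G -> X -> X) : Prop := IsAction {
  act1 : forall x, act 1%g x = x ;
  actM : forall g h x, act (g * h)%g x = act g (act h x) ;
  act_continuous : continuous (fun gx : G * X => act gx.1 gx.2)
}.

Definition G_map (U X : topologicalType) (actU : G -> U -> U)
    (actX : G -> X -> X) (f : U -> X) : Prop :=
  continuous f /\ forall g u, f (actU g u) = actX g (f u).

Variables (X : topologicalType) (act : G -> X -> X).

Definition Gorbit (x : X) : set X := range (act^~ x).

Definition G_invariant (U : set X) : Prop :=
  forall g x, U x -> U (act g x).

Variables (U : set X) (invU : G_invariant U).

Definition subact (g : G) (u : set_type U) : set_type U :=
  SigSub (mem_set (invU g (set_valP u))).

Lemma subact_action : is_action act -> is_action subact.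
Proof.
move=> [a1 aM ac]; split.
- by move=> u; apply: val_inj; rewrite /= a1.
- by move=> g h u; apply: val_inj; rewrite /= aM.
- apply: continuous_discrete_prod => g; apply: continuous_to_set_type => u /=.
  apply: continuous_comp; first exact: continuous_set_val.
  exact: (continuous_slice ac).
Qed.

End Actions.

(* The groupoid with objects [tg_obj] and arrows [tg_group * tg_obj], where
   [(g, x)] goes from [x] to [tg_act g x]; composition is the group law. *)
Record translation_groupoid := TranslationGroupoid {
  tg_group : discreteGroupType ;
  tg_obj : topologicalType ;
  tg_act : tg_group -> tg_obj -> tg_obj ;
  tg_actP : is_action tg_act ;
  tg_hausdorff : hausdorff_space tg_obj
}.

Arguments tg_act {_} _ _.

Record equivariant_map (A B : translation_groupoid) := EquivariantMap {
  em_group : UMagmaMorphism.type (tg_group A) (tg_group B) ;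
  em_obj : tg_obj A -> tg_obj B ;
  em_group_continuous : continuous em_group ;
  em_obj_continuous : continuous em_obj ;
  em_equivariant :
    forall k z, em_obj (tg_act k z) = tg_act (em_group k) (em_obj z)
}.

Section Equivariant_maps.

Lemma em_id_equivariant (A : translation_groupoid) k (z : tg_obj A) :
  idfun (tg_act k z) = tg_act (idfun k) (idfun z).
Proof. by []. Qed.

Definition em_id (A : translation_groupoid) : equivariant_map A A :=
  EquivariantMap (em_group := idfun) (@cts_fun _ _ idfun) (@cts_fun _ _ idfun)
    (@em_id_equivariant A).

Variables (A B C : translation_groupoid).
Variables (g : equivariant_map B C) (f : equivariant_map A B).

Lemma em_comp_group_continuous : continuous (em_group g \o em_group f).
Proof.
by move=> k; apply: continuous_comp; exact: em_group_continuous.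
Qed.

Lemma em_comp_obj_continuous : continuous (em_obj g \o em_obj f).
Proof. by move=> z; apply: continuous_comp; exact: em_obj_continuous. Qed.

Lemma em_comp_equivariant k z :
  (em_obj g \o em_obj f) (tg_act k z) =
  tg_act ((em_group g \o em_group f) k) ((em_obj g \o em_obj f) z).
Proof. by rewrite /= !em_equivariant. Qed.

Definition em_comp : equivariant_map A C :=
  EquivariantMap em_comp_group_continuous em_comp_obj_continuous
    em_comp_equivariant.

End Equivariant_maps.

Section Natural_transformations.
Variables (A B : translation_groupoid) (f g : equivariant_map A B).

Definition natural_transformation (l : tg_obj A -> tg_group B) : Prop :=
  [/\ continuous l,
      forall z, tg_act (l z) (em_obj f z) = em_obj g z &
      forall k z, (em_group g k * l z = l (tg_act k z) * em_group f k)%g].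

Definition nat_equiv : Prop := exists l, natural_transformation l.

End Natural_transformations.

Section Essential_equivalences.
Variables (A B : translation_groupoid) (e : equivariant_map A B).

Definition arrow_pullback :
    set ((tg_group B * tg_obj B) * (tg_obj A * tg_obj A)) :=
  [set p | p.1.2 = em_obj e p.2.1 /\ tg_act p.1.1 p.1.2 = em_obj e p.2.2].

Lemma to_arrow_pullback_subproof (kz : tg_group A * tg_obj A) :
  arrow_pullback ((em_group e kz.1, em_obj e kz.2), (kz.2, tg_act kz.1 kz.2)).
Proof. by split=> //=; rewrite em_equivariant. Qed.

Definition to_arrow_pullback (kz : tg_group A * tg_obj A) :
    set_type arrow_pullback :=
  SigSub (mem_set (to_arrow_pullback_subproof kz)).

Definition target_map (hz : tg_group B * tg_obj A) : tg_obj B :=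
  tg_act hz.1 (em_obj e hz.2).

Definition essential_equivalence : Prop :=
  [/\ open_map target_map, (forall y, exists hz, target_map hz = y) &
      homeomorphism to_arrow_pullback].

End Essential_equivalences.

Lemma em_id_essential (A : translation_groupoid) :
  essential_equivalence (em_id A).
Proof.
have [a1 aM ac] := tg_actP A; have ac1 := continuous_slice ac.
split.
- move=> O oO; suff -> : target_map (em_id A) @` O =
      \bigcup_(g : tg_group A)
        (fun y => (g, tg_act g^-1%g y)) @^-1` O.
    apply: bigcup_open => g _; move: oO; apply: open_comp => y _.
    by apply: cvg_pair => /=; [exact: cvg_cst | exact: ac1].
  apply/seteqP; split=> [y [[g z] Ogz <-]|y [g _ Ogy]].
    by exists g => //=; rewrite /target_map /= -aM mulVg a1.
  by exists (g, tg_act g^-1%g y) => //; rewrite /target_map /= -aM mulgV a1.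
- by move=> y; exists (1%g, y); rewrite /target_map /= a1.
- split.
    apply: continuous_to_set_type.
    apply: (@continuous_pair _ _ _ (fun kz => (kz.1, kz.2))
      (fun kz => (kz.2, tg_act kz.1 kz.2))).
      by apply: continuous_pair => kz; [exact: cvg_fst | exact: cvg_snd].
    by apply: continuous_pair => // kz; exact: cvg_snd.
  exists (fun p => ((val p).1.1, (val p).1.2)); split.
  + have cv := @continuous_set_val _ (arrow_pullback (em_id A)).
    apply: continuous_pair => p.
      by apply: (cvg_comp _ _ (cvg_comp _ _ (cv p) cvg_fst) cvg_fst).
    by apply: (cvg_comp _ _ (cvg_comp _ _ (cv p) cvg_fst) cvg_snd).
  + by case.
  + move=> p; apply: val_inj => /=.
    have [/=] := set_valP p.
    by case: (val p) => [[h y] [z z']] /= <- <-.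
Qed.

Record generalized_map (A B : translation_groupoid) := GeneralizedMap {
  gm_mid : translation_groupoid ;
  gm_left : equivariant_map gm_mid A ;
  gm_right : equivariant_map gm_mid B ;
  gm_essential : essential_equivalence gm_left
}.

Definition gm_of_em (A B : translation_groupoid) (f : equivariant_map A B) :
    generalized_map A B :=
  GeneralizedMap f (em_id_essential A).

Definition gm_postcomp (A B C : translation_groupoid)
    (f : equivariant_map B C) (h : generalized_map A B) :
    generalized_map A C :=
  GeneralizedMap (em_comp f (gm_right h)) (gm_essential h).

Definition two_isomorphic (A B : translation_groupoid)
    (f g : generalized_map A B) : Prop :=
  exists (L : translation_groupoid)
    (nu : equivariant_map L (gm_mid f)) (mu : equivariant_map L (gm_mid g)),
    [/\ essential_equivalence nu, essential_equivalence mu,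
        nat_equiv (em_comp (gm_left f) nu) (em_comp (gm_left g) mu) &
        nat_equiv (em_comp (gm_right f) nu) (em_comp (gm_right g) mu)].

Notation unit_interval R := (set_type (`[0%R, 1%R]%classic : set R)).

Section Unit_interval.
Variable R : realType.

Lemma unit_interval0_subproof : (0%R : R) \in (`[0%R, 1%R]%classic : set R).
Proof. by rewrite inE /= in_itv /= lexx ler01. Qed.

Lemma unit_interval1_subproof : (1%R : R) \in (`[0%R, 1%R]%classic : set R).
Proof. by rewrite inE /= in_itv /= lexx ler01. Qed.

Definition ui0 : unit_interval R := SigSub unit_interval0_subproof.
Definition ui1 : unit_interval R := SigSub unit_interval1_subproof.

End Unit_interval.

(* The continuous maps from [0, 1] to X, with the compact-open topology. *)
Definition path_space (R : realType) (X : topologicalType) : Type :=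
  continuousType (unit_interval R) X.

HB.instance Definition _ (R : realType) (X : topologicalType) :=
  Topological.copy (path_space R X)
    (initial_topology (fun p : continuousType (unit_interval R) X =>
       (p : {compact-open, unit_interval R -> X}))).

Section Path_spaces.
Variable R : realType.
Local Notation I := (unit_interval R).

Definition path_eval (X : topologicalType) (t : I) (p : path_space R X) : X :=
  (p : continuousType I X) t.


Lemma path_eval_continuous (X : topologicalType) (t : I) :
  continuous (@path_eval X t).
Proof.
apply/continuousP => O oO.
exists [set q : {compact-open, I -> X} | q @` [set t] `<=` O].
  by apply: compact_open_open => //; exact: compact_set1.
apply/seteqP; split=> [p pO|p Opt _ [_ -> <-]//].
by apply: pO; exists t.
Qed.

Lemma path_space_hausdorff (X : topologicalType) :
  hausdorff_space X -> hausdorff_space (path_space R X).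
Proof.
move=> hX p q cpq; apply/continuousEP => t; apply: hX => A B nA nB.
have [r [Ar Br]] := cpq _ _ (path_eval_continuous nA) (path_eval_continuous nB).
by exists (path_eval t r).
Qed.

Variable A : translation_groupoid.

Lemma path_act_continuous_subproof (g : tg_group A)
    (p : path_space R (tg_obj A)) :
  continuous (fun t => tg_act g (path_eval t p)).
Proof.
have cg := continuous_slice (act_continuous (tg_actP A)) (g := g).
move=> t; apply: (@continuous_comp I (tg_obj A) (tg_obj A)
  (fun t => path_eval t p) (tg_act g) t); last exact: cg.
exact: (@cts_fun _ _ (p : continuousType I (tg_obj A))).
Qed.

Definition path_act (g : tg_group A) (p : path_space R (tg_obj A)) :
    path_space R (tg_obj A) :=
  (mkcts (@path_act_continuous_subproof g p) : continuousType I (tg_obj A)).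

Lemma path_act_action : is_action path_act.
Proof.
have [a1 aM ac] := tg_actP A.
split.
- by move=> p; apply/continuousEP => t; exact: a1.
- by move=> g h p; apply/continuousEP => t; exact: aM.
apply: continuous_discrete_prod => g p V [_ [[W oW <-] /= Wgp WV]].
pose F (q : path_space R (tg_obj A)) : {compact-open, I -> tg_obj A} :=
  fun t => tg_act g (path_eval t q).
have : nbhs p (F @^-1` W).
  have : F q @[q --> p] --> F p; last by apply; exact: open_nbhs_nbhs.
  apply/compact_open_cvgP; first by apply: fmap_filter; exact: nbhs_filter.
  move=> K O cK oO FKO.
  apply: open_nbhs_nbhs; split; last exact: FKO.
  exists [set q : {compact-open, I -> tg_obj A} |
           q @` K `<=` tg_act g @^-1` O].
    apply: compact_open_open => //; apply: open_comp oO => x _.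
    exact: continuous_slice ac g x.
  apply/seteqP; split=> [q qO _ [t Kt <-]|q qO _ [t Kt <-]] /=.
    by apply: qO; exists t.
  by apply: qO; exists t.
by apply: filterS => q Fq; apply: WV.
Qed.

Definition path_groupoid : translation_groupoid :=
  TranslationGroupoid path_act_action (path_space_hausdorff (@tg_hausdorff A)).

Lemma ev_equivariant (t : I) (g : tg_group path_groupoid)
    (p : tg_obj path_groupoid) :
  path_eval t (tg_act g p) = @tg_act A (idfun g) (path_eval t p).
Proof. by []. Qed.

Definition ev (t : I) : equivariant_map path_groupoid A :=
  EquivariantMap (A := path_groupoid) (B := A) (em_group := idfun)
    (@cts_fun _ _ idfun) (@path_eval_continuous _ t) (@ev_equivariant t).

End Path_spaces.

Definition grd_homotopic (R : realType) (A B : translation_groupoid)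
    (f g : equivariant_map A B) : Prop :=
  exists H : generalized_map A (path_groupoid R B),
    two_isomorphic (gm_postcomp (ev B (ui0 R)) H) (gm_of_em f) /\
    two_isomorphic (gm_postcomp (ev B (ui1 R)) H) (gm_of_em g).

Section Sub_groupoid.
Variables (A : translation_groupoid) (U : set (tg_obj A)).
Hypothesis invU : G_invariant (@tg_act A) U.

Lemma sub_hausdorff : hausdorff_space (set_type U).
Proof.
apply: (@hausdorff_inj (set_type U) (tg_obj A) val) (@tg_hausdorff A).
  exact: val_inj.
exact: continuous_set_val.
Qed.

Definition sub_groupoid : translation_groupoid :=
  TranslationGroupoid (subact_action invU (tg_actP A)) sub_hausdorff.

Definition sub_inclusion : equivariant_map sub_groupoid A :=
  EquivariantMap (A := sub_groupoid) (B := A) (em_group := idfun)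
    (@cts_fun _ _ idfun) (@continuous_set_val _ U) (fun _ _ => erefl).

End Sub_groupoid.

Definition grd_categorical (R : realType) (A : translation_groupoid)
    (U : set (tg_obj A)) : Prop :=
  exists (invU : G_invariant (@tg_act A) U)
    (c : equivariant_map (sub_groupoid invU) A),
    grd_homotopic R (sub_inclusion invU) c /\
    exists x, range (em_obj c) `<=` Gorbit (@tg_act A) x.

Section Equivariant_category.
Variables (R : realType) (G : discreteGroupType).

Definition G_homotopic (U X : topologicalType) (actU : G -> U -> U)
    (actX : G -> X -> X) (f0 f1 : U -> X) : Prop :=
  exists F : U * unit_interval R -> X,
    [/\ G_map (fun g ut => (actU g ut.1, ut.2)) actX F,
        forall u, F (u, ui0 R) = f0 u &
        forall u, F (u, ui1 R) = f1 u].

Definition G_categorical (X : topologicalType) (act : G -> X -> X)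
    (U : set X) : Prop :=
  exists (invU : G_invariant act U) (c : set_type U -> X),
    [/\ G_map (subact invU) act c,
        G_homotopic (subact invU) act val c &
        exists x, range c `<=` Gorbit act x].

End Equivariant_category.

Section Covering_number.

Definition open_cover_by (X : topologicalType) (P : set X -> Prop) (k : nat) :
    Prop :=
  exists U : 'I_k -> set X,
    (forall i, open (U i) /\ P (U i)) /\ \bigcup_i U i = [set: X].

(* [None] stands for the value infinity. *)
Definition covering_number (X : topologicalType) (P : set X -> Prop) :
    option nat :=
  match pselect (exists k, `[< open_cover_by P k >]) with
  | left e => Some (ex_minn e)
  | right _ => None
  end.

End Covering_number.

Definition cat_G (R : realType) (G : discreteGroupType) (X : topologicalType)
    (act : G -> X -> X) : option nat :=
  covering_number (G_categorical R act).

Definition cat_grd (R : realType) (A : translation_groupoid) : option nat :=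
  covering_number (@grd_categorical R A).

(* Main.v *)
(** The path component of a grd-homotopy lives over some [K ⋉ Z] that is only
    essentially equivalent to [G ⋉ U], but evaluation at 0 is 2-isomorphic to
    an honest equivariant map.  Because evaluation is the identity on the
    structure group, the natural transformation witnessing this also twists the
    path-valued map itself into one that descends to [U]: this yields a strict
    [G]-map [U -> X^I] starting at the inclusion, i.e. a [G]-homotopy.  Its end
    point stays in one orbit since 2-isomorphisms preserve orbits. *)
Require Import Defs.
From mathcomp Require Import all_boot all_order all_algebra.
From mathcomp Require Import all_classical all_reals topology.
From mathcomp Require Import normed_module.

Set Implicit Arguments.
Unset Strict Implicit.
Unset Printing Implicit Defensive.

Import numFieldTopology.Exports.

Local Open Scope classical_set_scope.

(** A cluster point in [A] of the image filter also clusters in the subspace, whose open sets are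
    traces of open sets of [T]. *)
Lemma compact_set_type (T : topologicalType) (A : set T) :
  compact A -> compact [set: set_type A].
Proof.
move=> cA F FF _.
have [|p [Ap clp]] := cA (val @ F) (fmap_proper_filter _ FF).
  by apply: (@filterE _ F) => u; exact: set_valP.
exists (SigSub (mem_set Ap)); split=> // P Q FP [_ [[B oB <-] /= Bp BQ]].
have [||_ [[u Pu <-] Bu]] := clp (val @` P) B.
- by apply: (@filterS _ F _ _ _ _ FP) => u Pu; exists u.
- exact: open_nbhs_nbhs.
- by exists u; split => //; exact: BQ.
Qed.

Section Unit_interval.
Variable R : realType.
Local Notation I := (set_type (`[0%R, 1%R]%classic : set R)).

Lemma unit_interval_hausdorff : hausdorff_space I.
Proof.
apply: (@hausdorff_inj I R val); first exact: val_inj.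
  exact: continuous_set_val.
exact: Rhausdorff.
Qed.

Lemma unit_interval_locally_compact : locally_compact [set: I].
Proof.
have cI : compact [set: I] by apply: compact_set_type; exact: segment_compact.
move=> x _; exists [set: I]; first by rewrite withinET; exact: filterT.
by split => //; exact: closedT.
Qed.

Lemma path_curry_continuous (S X : topologicalType) (F : S -> path_space R X) :
  continuous (fun st : S * I => path_eval st.2 (F st.1)) -> continuous F.
Proof.
move=> cF; apply: continuous_comp_initial.
exact: (@continuous_curry_fun S I X (fun st => path_eval st.2 (F st.1))).
Qed.

(** The half of the exponential law that rests on [I] being locally compact and Hausdorff. *)
Lemma path_uncurry_continuous (S X : topologicalType)
    (F : S -> path_space R X) :
  continuous F -> continuous (fun st : S * I => path_eval st.2 (F st.1)).
Proof.
move=> cF.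
pose f (s : S) : {compact-open, I -> X} := fun t => path_eval t (F s).
have cf : continuous f.
  move=> s; apply: (continuous_comp (cF s)); exact: initial_continuous.
rewrite (_ : (fun _ => _) = uncurry f); last by apply/funext => -[].
apply: continuous_uncurry cf _; first exact: unit_interval_locally_compact.
  exact: unit_interval_hausdorff.
by move=> s; exact: (@cts_fun _ _ (F s)).
Qed.

End Unit_interval.

Section Essential_equivalences.
Variables (A B : translation_groupoid) (e : equivariant_map A B).
Hypothesis ee : essential_equivalence e.

Lemma essential_surjective b :
  exists g a, b = tg_act g (em_obj e a).
Proof. by have [_ /(_ b)[[g a] <-] _] := ee; exists g, a. Qed.

(** The arrow [g] together with [(a, a')] is a point of the pullback, and the inverse homeomorphism
    sends it to the required [k]. *)
Lemma essential_full (g : tg_group B) a a' :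
  tg_act g (em_obj e a) = em_obj e a' ->
  exists2 k, tg_act k a = a' & em_group e k = g.
Proof.
move=> ga; have [_ _ [_ [inv [_ _ Kinv]]]] := ee.
have pP : arrow_pullback e ((g, em_obj e a), (a, a')) by [].
have := congr1 val (Kinv (SigSub (mem_set pP))).
by case: (inv _) => k z /= [<- _ <- <-]; exists k.
Qed.

(** Equivariance forces the value [actY g (f a)] at [tg_act g (em_obj e a)]. Fullness of [e] makes
    it independent of the choice of [(g, a)], and openness of [target_map] makes it continuous. *)
Lemma essential_descent (Y : topologicalType) (actY : tg_group B -> Y -> Y)
    (f : tg_obj A -> Y) :
  is_action actY -> continuous f ->
  (forall k a, f (tg_act k a) = actY (em_group e k) (f a)) ->
  exists2 F : tg_obj B -> Y, G_map (@tg_act B) actY F &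
    forall g a, F (tg_act g (em_obj e a)) = actY g (f a).
Proof.
move=> [y1 yM yc] cf fE.
have [b1 bM _] := tg_actP B.
have [op surj _] := ee.
pose F b := let ga := sval (cid (surj b)) in actY ga.1 (f ga.2).
have FE g a : F (tg_act g (em_obj e a)) = actY g (f a).
  rewrite /F; case: cid => -[h a'] /= /esym.
  rewrite /target_map /= => ga.
  (* Two presentations of one point differ by an arrow between images of [e], which lifts to [k]. *)
  have [|k <- kE] := @essential_full (h^-1 * g)%g a a'.
    by rewrite bM ga -bM mulVg b1.
  by rewrite fE kE -yM mulgA mulgV mul1g.
exists F => //; split; last first.
  by move=> g b; have [h [a ->]] := essential_surjective b; rewrite -bM !FE yM.
apply/continuousP => O oO.
have -> : F @^-1` O =
    target_map e @` ((fun ga => actY ga.1 (f ga.2)) @^-1` O).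
  apply/seteqP; split => [b|b [[g a] /= Oga <-]]; last by rewrite /= FE.
  have [g [a ->]] := essential_surjective b.
  by rewrite /= FE => Oga; exists (g, a).
apply: op; move: O oO; apply/continuousP.
apply: (@continuous_discrete_prod _ _ _ (fun g a => actY g (f a))) => g a.
by apply: continuous_comp; [exact: cf | exact: (continuous_slice yc)].
Qed.

End Essential_equivalences.

(** Up to the group action [z] lies in the image of [nu], and there the natural transformation moves
    one map to the other within an orbit. *)
Lemma two_isomorphic_orbit (A B : translation_groupoid)
    (f g : generalized_map A B) :
  two_isomorphic f g -> forall z, exists b z',
    em_obj (gm_right f) z = tg_act b (em_obj (gm_right g) z').
Proof.
move=> [L [nu [mu [enu _ _ [l [_ lE _]]]]]] z.
have [_ bM _] := tg_actP B.
have [k [w ->]] := essential_surjective enu z.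
exists (em_group (gm_right f) k * (l w)^-1)%g, (em_obj mu w).
by rewrite em_equivariant -[em_obj _ (em_obj mu w)]lE -bM -mulgA mulVg mulg1.
Qed.

(** Turns the path-valued generalized map into a strict equivariant one, given that its evaluation
    at [t] is 2-isomorphic to [f]. *)
Lemma path_lift (R : realType) (A B : translation_groupoid)
    (H : generalized_map A (path_groupoid R B)) t (f : equivariant_map A B) :
  two_isomorphic (gm_postcomp (ev B t) H) (gm_of_em f) ->
  exists F : tg_obj A -> path_space R (tg_obj B),
  [/\ continuous F,
      forall g a, F (tg_act g a) = path_act (em_group f g) (F a),
      forall a, path_eval t (F a) = em_obj f a &
      forall a, exists g z, F a = path_act g (em_obj (gm_right H) z)].
Proof.
move=> [L [nu [mu [_ emu _ [l [cl lE lN]]]]]].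
have [p1 pM pc] := path_act_action R B.
(* Paths carry an action of the group of [A] through [f]. *)
pose actA g (p : path_space R (tg_obj B)) := path_act (em_group f g) p.
have actAP : is_action actA.
  split.
  - by move=> p; rewrite /actA gmulf1 p1.
  - by move=> g h p; rewrite /actA gmulfM pM.
  - by apply: continuous_discrete_prod => g; exact: (continuous_slice pc).
(* As [ev] is the identity on groups, [l] can twist whole paths; its naturality is exactly the
   equivariance of [psi], which then descends along [mu]. *)
pose psi w := path_act (l w) (em_obj (gm_right H) (em_obj nu w)).
have cpsi : continuous psi.
  have clH :=
    continuous_pair cl (@em_obj_continuous _ _ (em_comp (gm_right H) nu)).
  by move=> w; exact: (continuous_comp (clH w) (pc _)).
have psiE k w : psi (tg_act k w) = actA (em_group mu k) (psi w).
  by rewrite /psi /actA !em_equivariant -[RHS]pM (lN k w) [RHS]pM.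
have [F [cF FA] FE] := essential_descent emu actAP cpsi psiE.
exists F; split=> // a; have [g [w ->]] := essential_surjective emu a.
  rewrite FE em_equivariant; congr tg_act; exact: lE.
rewrite FE; exists (em_group f g * l w)%g, (em_obj nu w).
by rewrite pM.
Qed.

(** Pointwise agreement avoids comparing the proof fields of the records; the constant
    transformation [1] is the witness. *)
Lemma two_isomorphic_eq (A B : translation_groupoid)
    (f g : equivariant_map A B) :
  em_group f =1 em_group g -> em_obj f =1 em_obj g ->
  two_isomorphic (gm_of_em f) (gm_of_em g).
Proof.
move=> fg_group fg_obj; exists A, (em_id A), (em_id A).
have c1 C : continuous (fun _ : tg_obj A => 1%g : tg_group C).
  by move=> z; exact: cvg_cst.
split; try exact: em_id_essential.
- exists (fun _ => 1%g); split => //.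
    by move=> z; rewrite (act1 (tg_actP A)).
  by move=> k z; rewrite mulg1 mul1g.
- exists (fun _ => 1%g); split => //.
    by move=> z; rewrite (act1 (tg_actP B)); exact: fg_obj.
  by move=> k z; rewrite mulg1 mul1g /= fg_group.
Qed.

Lemma grd_categorical_iff (R : realType) (G : discreteGroupType)
    (X : topologicalType) (act : G -> X -> X)
    (actP : is_action act) (hX : hausdorff_space X) (U : set X) :
  @grd_categorical R (TranslationGroupoid actP hX) U <-> G_categorical R act U.
Proof.
have [_ aM _] := actP.
split=> [[invU [c [[H [H0 H1]] [x cx]]]]|
         [invU [c [cG [F [[cF FG] F0 F1]] cx]]]].
- have [P [cP PG P0 PH]] := path_lift H0.
  have P1c u : exists g v, path_eval (ui1 R) (P u) = act g (em_obj c v).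
    have [g [z ->]] := PH u.
    have [b [v vE]] := two_isomorphic_orbit H1 z.
    by exists (g * b)%g, v; rewrite aM; congr (act g); exact: vE.
  (* The end map is that of the lifted paths, which may differ from [c] but stays in the same orbit
     by [P1c]. *)
  exists invU, (fun u => path_eval (ui1 R) (P u)); split.
  + split; first by move=> u; apply: continuous_comp;
      [exact: cP | exact: path_eval_continuous].
    by move=> g u; rewrite PG.
  + exists (fun ut => path_eval ut.2 (P ut.1)); split => //.
    split; first exact: path_uncurry_continuous.
    by move=> g [u t]; rewrite /= PG.
  + exists x => _ [u _ <-].
    have [g [v ->]] := P1c u.
    have [|h _ <-] := cx (em_obj c v); first by exists v.
    by exists (g * h)%g => //; rewrite aM.
- have cF' : continuous (fun ut => F (ut.1, ut.2)).
    by rewrite (_ : (fun _ => _) = F) //; apply/funext => -[].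
  have cFu u : continuous (fun t => F (u, t)).
    exact: (continuous_slice (f := fun u t => F (u, t)) cF').
  pose A := TranslationGroupoid actP hX.
  (* Conversely, the adjoint of a [G]-homotopy is a strict map into paths, hence a generalized map
     with identity left leg. *)
  pose P (u : set_type U) : path_space R X :=
    mkcts (cFu u) : continuousType _ _.
  have cP : continuous P by exact: path_curry_continuous.
  have PG g u : P (subact invU g u) = @path_act R A g (P u).
    by apply/continuousEP => t; exact: (FG g (u, t)).
  pose Pm : equivariant_map (@sub_groupoid A U invU) (path_groupoid R A) :=
    EquivariantMap (A := @sub_groupoid A U invU) (B := path_groupoid R A)
      (em_group := idfun) (@cts_fun _ _ idfun) cP PG.
  pose cm : equivariant_map (@sub_groupoid A U invU) A :=
    EquivariantMap (A := @sub_groupoid A U invU) (B := A)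
      (em_group := idfun) (@cts_fun _ _ idfun) cG.1 cG.2.
  exists invU, cm; split => //.
  exists (gm_of_em Pm); split.
  + exact: (@two_isomorphic_eq _ _ (em_comp (ev A (ui0 R)) Pm)).
  + exact: (@two_isomorphic_eq _ _ (em_comp (ev A (ui1 R)) Pm) cm).
Qed.

Theorem theorem6p7 (R : realType) (G : discreteGroupType)
    (X : topologicalType) (act : G -> X -> X)
    (actP : is_action act) (hX : hausdorff_space X) :
  cat_grd R (TranslationGroupoid actP hX) = cat_G R act.
Proof.
rewrite /cat_grd /cat_G; congr covering_number.
by apply/funext => U; apply/propext; exact: grd_categorical_iff.
Qed.
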